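(* Let $1\le m\le n-1$ be integers and let $p$ be a prime large enough that $$p^{m(n-m)}\le \binom{n}{m}_p\le 2\,p^{m(n-m)}.$$ Let $E\subset \mathbb{F}_p^n$ with $|E|=p^{s}$, where $s$ is a real number. Then: (a) if $s\le m$ and $t\in(0,s]$, then $$\left|\{W\in G(n,n-m): |\pi^{W}(E)|\le p^{t}/10\}\right|\le \tfrac12\,p^{m(n-m)-(m-t)};$$ (b) if $s>m$, then $$\left|\{W\in G(n,n-m): |\pi^{W}(E)|\le p^{m}/10\}\right|\le \tfrac12\,p^{m(n-m)-(s-m)};$$ (c) if $s>2m$, then $$\left|\{W\in G(n,n-m): |\pi^{W}(E)|\ne p^{m}\}\right|\le 4\,p^{m(n-m)-(s-2m)}.$$
   Context: $\mathbb{F}_p$ is the field with $p$ elements ($p$ prime). $|J|$ denotes the cardinality of a finite set $J$. $G(n,k)$ denotes the set of all $k$-dimensional linear subspaces of $\mathbb{F}_p^n$. The Gaussian binomial coefficient is $$\binom{n}{m}_p=\frac{(p^n-1)(p^n-p)\cdots(p^n-p^{m-1})}{(p^m-1)(p^m-p)\cdots(p^m-p^{m-1})}=|G(n,m)|.$$ For a subspace $W$ of $\mathbb{F}_p^n$ and $E\subset\mathbb{F}_p^n$, $\pi^W(E)$ is the set of cosets of $W$ that meet $E$: $$\pi^{W}(E)=\{x+W: x\in\mathbb{F}_p^n,\ E\cap(x+W)\ne\emptyset\}.$$ *)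

(* Defs.v *)
From HB Require Import structures.
From mathcomp Require Import all_boot all_order all_algebra.
From mathcomp Require Import all_classical all_reals all_analysis.

Set Implicit Arguments.
Unset Strict Implicit.
Unset Printing Implicit Defensive.

Import Order.TTheory GRing.Theory Num.Theory.

Local Open Scope ring_scope.

(* Over a finite field, a subspace is encoded by a canonical generating square
   matrix, so there are finitely many subspaces. *)
Section FiniteVspace.
Import VectorInternalTheory.
Variables (F : finFieldType) (vT : vectType F).

HB.instance Definition _ := [Countable of {vspace vT} by <:].
HB.instance Definition _ := [Finite of {vspace vT} by <:].

End FiniteVspace.

Definition Grassmannian (p n k : nat) : {set {vspace 'rV['F_p]_n}} :=
  [set W : {vspace 'rV['F_p]_n} | \dim W == k].

Definition vcoset (p n : nat) (x : 'rV['F_p]_n) (W : {vspace 'rV['F_p]_n}) :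
    {set 'rV['F_p]_n} :=
  [set x + w | w in W].

Definition cosets_meeting (p n : nat) (W : {vspace 'rV['F_p]_n})
    (E : {set 'rV['F_p]_n}) : {set {set 'rV['F_p]_n}} :=
  [set vcoset x W | x : 'rV['F_p]_n & E :&: vcoset x W != finset.set0].

Definition gauss_binomial (R : fieldType) (p n m : nat) : R :=
  (\prod_(i < m) (p%:R ^+ n - p%:R ^+ i))
  / (\prod_(i < m) (p%:R ^+ m - p%:R ^+ i)).

(* Main.v *)
Require Import Defs.
From HB Require Import structures.
From mathcomp Require Import all_boot all_order all_algebra.
From mathcomp Require Import all_field all_character.
From mathcomp Require Import all_classical all_reals all_analysis.
From mathcomp Require Import ring lra.

Set Implicit Arguments.
Unset Strict Implicit.
Unset Printing Implicit Defensive.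

Import Order.TTheory GRing.Theory Num.Theory.

Local Open Scope ring_scope.

(* Let [P_W] be the number of pairs [(x, y)] in [E * E] with [x - y \in W].
   Cauchy-Schwarz over the cosets of [W] gives [|E|^2 <= |pi^W(E)| P_W], so a
   small projection forces a large [P_W].  A nonzero vector lies in at most a
   fraction [p^-m] of the subspaces of codimension [m], because the linear group
   is transitive on nonzero vectors; hence [sum_W P_W <= |G| (|E| + |E|^2 / p^m)].
   Since always [P_W >= |E|] and [P_W >= |E|^2 / p^m], Markov's inequality applied
   to [P_W - |E|] yields (a), and applied to [P_W - |E|^2 / p^m] yields (b) and
   (c). *)

(** * Cauchy-Schwarz and the fibres of a map *)

Lemma sqr_sum_leq (I : finType) (A : {set I}) (a : I -> nat) :
  ((\sum_(i in A) a i) ^ 2 <= #|A| * \sum_(i in A) a i ^ 2)%N.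
Proof.
(* After doubling, both sides are double sums over [A], compared term by term through
   [2 a_i a_j <= a_i^2 + a_j^2]. *)
rewrite -mulnn -(leq_pmul2l (isT : 0 < 2)%N) big_distrl /=.
under eq_bigr do rewrite big_distrr /=.
have -> : (2 * (#|A| * \sum_(i in A) a i ^ 2) =
  \sum_(i in A) \sum_(j in A) (a i ^ 2 + a j ^ 2))%N.
  under [RHS]eq_bigr do rewrite big_split /= sum_nat_const.
  by rewrite big_split /= sum_nat_const -big_distrr /= mul2n addnn.
rewrite big_distrr /= leq_sum // => i _; rewrite big_distrr /= leq_sum // => j _.
by rewrite (nat_Cauchy _ _).1.
Qed.

(** The fibre sizes add up to [#|A|] and their squares to the number of pairs with equal image, so
    this is Cauchy-Schwarz over the image points. *)
Lemma card_sqr_leq_fiber_pairs (T T' : finType) (f : T -> T') (A : {set T}) :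
  (#|A| ^ 2 <= #|f @: A| * #|[set u in finset.setX A A | f u.1 == f u.2]|)%N.
Proof.
have -> : #|[set u in finset.setX A A | f u.1 == f u.2]| =
    (\sum_(c in f @: A) #|[set x in A | f x == c]| ^ 2)%N.
  rewrite -sum1dep_card
    (eq_bigl (fun u : T * T => (u.1 \in A) && ((u.2 \in A) && (f u.2 == f u.1)))); last first.
    by move=> u; rewrite !inE andbA [f u.2 == _]eq_sym.
  rewrite -(pair_big_dep (mem A) (fun x y => (y \in A) && (f y == f x)) (fun _ _ => 1%N)) /=.
  rewrite (partition_big_imset f) /=; apply: eq_bigr => c _.
  rewrite (eq_bigr (fun=> #|[set x in A | f x == c]|)); last first.
    by move=> x /andP[_ /eqP->]; rewrite sum1dep_card.
  by rewrite sum_nat_cond_const mulnn.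
apply: leq_trans (sqr_sum_leq _ _); rewrite leq_sqr -sum1_card (partition_big_imset f) /=.
by apply: leq_sum => c _; rewrite sum1dep_card.
Qed.

(** * Counting full-rank matrices and subspaces over a finite field *)

Lemma row_free_col_mx_row (F : fieldType) (m n : nat) (u : 'rV[F]_n) (A : 'M[F]_(m, n)) :
  row_free (col_mx u A) = row_free A && ~~ (u <= A)%MS.
Proof.
rewrite /row_free -addsmxE; case: (boolP (u <= A)%MS) => uA /=.
  by rewrite andbF (addsmx_idPr uA) ltn_eqF // ltnS rank_leq_row.
rewrite andbT mxrank_disjoint_sum.
  by rewrite rank_rV (_ : u != 0) ?eqn_add2l //; apply: contra uA => /eqP->; rewrite sub0mx.
apply/eqP; rewrite -mxrank_eq0; apply: contraR uA => uA0.
(* A nonzero intersection has rank at least 1, so it is the whole line spanned by [u], and [u] lies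
   in the row space of [A]. *)
apply: submx_trans (capmxSr u A).
rewrite -(geq_leqif (mxrank_leqif_sup (capmxSl u A))).
by apply: leq_trans (rank_leq_row _) _; rewrite lt0n.
Qed.

(** Rows are added one at a time: the row joined to [i] independent ones must avoid their span,
    which has [#|F| ^ i] elements. *)
Lemma card_row_free (F : finFieldType) (m n : nat) :
  #|[set A : 'M[F]_(m, n) | row_free A]| = (\prod_(i < m) (#|F| ^ n - #|F| ^ i))%N.
Proof.
elim: m => [|m IHm].
  rewrite big_ord0 (_ : [set _ | _] = finset.setT) ?finset.cardsT ?card_mx ?mul0n //.
  by apply/setP=> A; rewrite !inE /row_free -leqn0 rank_leq_row.
rewrite big_ord_recr /= -{}IHm.
pose h (u : 'M[F]_(m, n) * 'rV[F]_n) : 'M[F]_(1 + m, n) := col_mx u.2 u.1.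
have h_inj : injective h by move=> [A u] [B v] /eq_col_mx[/= -> ->].
rewrite -[m.+1]/(1 + m)%N.
have -> : [set A : 'M[F]_(1 + m, n) | row_free A] =
    h @: [set u | row_free u.1 && ~~ (u.2 <= u.1)%MS].
  apply/setP=> A; rewrite inE -[A]vsubmxK row_free_col_mx_row.
  apply/idP/imsetP => [AF|[u]].
    by exists (dsubmx A, usubmx A); rewrite ?inE.
  by rewrite inE => uF /eq_col_mx[-> ->].
rewrite card_imset // -sum1dep_card.
rewrite -(pair_big_dep (fun A => row_free A)
  (fun (A : 'M[F]_(m, n)) u => ~~ (u <= A)%MS) (fun _ _ => 1%N)) /=.
rewrite -sum1dep_card big_distrl /=; apply: eq_bigr => A /eqP rA.
rewrite sum1dep_card mul1n.
have -> : (#|F| ^ m)%N = #|rowg A| by rewrite card_rowg rA.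
have -> : (#|F| ^ n)%N = #|'rV[F]_n| by rewrite card_mx mul1n.
by rewrite -(cardC (rowg A)) addKn; apply: eq_card => u; rewrite !inE.
Qed.

(** Carries a subspace over to matrix algebra, where ranks and cokernels are available. *)
Lemma row_free_vbasis (F : fieldType) (n : nat) (W : {vspace 'rV[F]_n}) :
  exists2 B : 'M[F]_(\dim W, n), row_free B & forall v, (v \in W) = (v <= B)%MS.
Proof.
pose B := \matrix_(i < \dim W) (vbasis W)`_i.
have BE v : v *m B = \sum_i v 0 i *: (vbasis W)`_i.
  by rewrite mulmx_sum_row; apply: eq_bigr => i _; rewrite rowK.
exists B => [|v].
  apply: inj_row_free => v; rewrite BE => v0; apply/rowP=> i; rewrite mxE.
  by move/freeP: (basis_free (vbasisP W)) => /(_ (fun i => v 0 i) v0 i).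
apply/idP/submxP => [/coord_vbasis vE|[D ->]].
  exists (\row_i coord (vbasis W) i v); rewrite BE {1}vE.
  by apply: eq_bigr => i _; rewrite mxE.
rewrite BE memv_suml // => i _; rewrite memvZ // vbasis_mem // mem_nth //.
by rewrite size_tuple.
Qed.

(** The cokernel of a basis matrix has kernel [W] and rank [m], but it is square of size [n]. In its
    rank factorisation the row factor is injective, so the column factor, with only [m] columns, has
    the same kernel. *)
Lemma vspace_kermx (F : fieldType) (m n : nat) (W : {vspace 'rV[F]_n}) :
  (m <= n)%N -> \dim W = (n - m)%N ->
  exists2 A : 'M[F]_(n, m), row_free A^T & forall v, (v \in W) = (v *m A == 0).
Proof.
move=> mn dW; have [B /eqP rB WB] := row_free_vbasis W.
have rC : \rank (cokermx B) = m by rewrite mxrank_coker rB dW subKn.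
suff: exists2 A : 'M[F]_(n, \rank (cokermx B)), row_free A^T &
  forall v, (v \in W) = (v *m A == 0) by rewrite rC.
exists (col_base (cokermx B)) => [|v].
  by rewrite /row_free mxrank_tr -/(row_full _) col_base_full.
rewrite WB submxE -{1}(mulmx_base (cokermx B)) mulmxA.
apply/eqP/eqP => [v0|->]; last by rewrite mul0mx.
by apply: (row_free_inj (row_base_free (cokermx B))); rewrite v0 mul0mx.
Qed.

(* Each subspace of codimension [m] is the kernel of at least [|GL_m|] matrices
   of full rank [m]. *)
Lemma card_codim_leq (F : finFieldType) (m n : nat) : (m <= n)%N ->
  (#|[set W : {vspace 'rV[F]_n} | \dim W == n - m]|
     * \prod_(i < m) (#|F| ^ m - #|F| ^ i) <= \prod_(i < m) (#|F| ^ n - #|F| ^ i))%N.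
Proof.
move=> mn; set G := [set W | _].
have /fin_all_exists[h hP] (W : {vspace 'rV[F]_n}) : exists A : 'M[F]_(n, m),
    W \in G -> row_free A^T /\ forall v, (v \in W) = (v *m A == 0).
  case: (boolP (W \in G)) => [|_]; last by exists 0.
  by rewrite inE => /eqP /(vspace_kermx mn)[A Af AW]; exists A.
(* For row-free [g], the transpose of [k (W, g)] still has kernel [W]. The product thus determines
   [W], and then [g] by cancelling [(h W)^T]. *)
pose k (u : {vspace 'rV[F]_n} * 'M[F]_m) : 'M[F]_(m, n) := u.2 *m (h u.1)^T.
rewrite -!card_row_free -cardsX -(@card_in_imset _ _ k) => [|[V a] [W b]].
  apply/subset_leq_card/fintype.subsetP=> A /imsetP[[W g]].
  rewrite finset.in_setX => /andP[/= /hP[hf _] gf] ->.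
  by move: gf; rewrite !inE /row_free /k /= mxrankMfree.
rewrite !finset.in_setX => /andP[/= VG +] /andP[/= WG +]; rewrite !inE /k /=.
have [fV hV] := hP _ VG; have [fW hW] := hP _ WG => fa fb ab.
have ker0 (c : 'M[F]_m) (A : 'M[F]_(n, m)) (v : 'rV_n) : row_free c ->
    (v *m A == 0) = (v *m (c *m A^T)^T == 0).
  move=> fc; rewrite trmx_mul trmxK mulmxA.
  have ct : row_free c^T by rewrite /row_free mxrank_tr.
  by rewrite -{2}(mul0mx _ c^T) (inj_eq (row_free_inj ct)).
have VW : V = W.
  by apply/vspaceP => v; rewrite hV hW (ker0 a (h V)) // (ker0 b (h W)) // ab.
by rewrite {}VW in ab hV *; congr pair; apply: row_free_inj ab.
Qed.

(** An invertible map taking [u] to [v] acts injectively on subspaces and preserves dimension. *)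
Lemma leq_card_subspaces_containing (F : finFieldType) (n k : nat) (u v : 'rV[F]_n) :
  u != 0 -> v != 0 ->
  (#|[set W : {vspace 'rV[F]_n} | (\dim W == k) && (u \in W)]|
   <= #|[set W : {vspace 'rV[F]_n} | (\dim W == k) && (v \in W)]|)%N.
Proof.
move=> u0 v0.
have uf : row_free u by rewrite /row_free rank_rV u0.
(* The rank-one matrix [pinvmx u *m v] takes [u] to [v]; [complete_unitmx] replaces it by an
   invertible matrix with the same value at [u]. *)
have uv : u *m (pinvmx u *m v) = v by rewrite mulmxA mulmxVp // mul1mx.
have /complete_unitmx[g gU gE] : \rank (u *m (pinvmx u *m v)) = \rank u.
  by rewrite uv !rank_rV u0 v0.
pose f : 'End('rV[F]_n) := linfun (mulmxr g).
have fE w : f w = w *m g by rewrite lfunE.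
have fker : lker f == 0%VS.
  by apply/lker0P => x y; rewrite !fE => /(can_inj (mulmxK gU)).
rewrite -(card_imset _ (_ : injective (fun W => f @: W)%VS)); last first.
  by move=> V W /eqP; rewrite eq_limg_ker0 // => /eqP.
apply/subset_leq_card/fintype.subsetP => _ /imsetP[W + ->]; rewrite !inE => /andP[/eqP dW uW].
rewrite limg_dim_eq ?(eqP fker) ?capv0 // dW eqxx /= -uv gE -fE.
exact: memv_img.
Qed.

(** Double counting of the pairs of a nonzero [w] and a [W] containing it: with [q = #|F|], each [w]
    lies in at least [K] subspaces and each [W] has [q^(n-m) - 1] nonzero vectors. The claim follows
    from [(q^(n-m) - 1) q^m <= q^n - 1]. *)
Lemma card_subspaces_containing (F : finFieldType) (n m : nat) (v : 'rV[F]_n) :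
  (m <= n)%N -> v != 0 ->
  (#|[set W : {vspace 'rV[F]_n} | (\dim W == n - m) && (v \in W)]| * #|F| ^ m
   <= #|[set W : {vspace 'rV[F]_n} | \dim W == n - m]|)%N.
Proof.
move=> mn v0; set K := #|_|; set G := [set W | _].
have F1 : (1 < #|F|)%N by apply: finNzRing_gt1.
have n0 : (0 < n)%N.
  by case: n {mn K G} v v0 => // v; rewrite (_ : v = 0) ?eqxx //; apply/rowP; case.
have cV : #|[set w : 'rV[F]_n | w != 0]| = (#|F| ^ n).-1.
  rewrite (_ : [set w | _] = [set~ 0]) ?cardsC1 ?card_mx ?mul1n //.
  by apply/setP=> w; rewrite !inE.
have cW W : W \in G -> #|[set w : 'rV[F]_n | (w != 0) && (w \in W)]| = (#|F| ^ (n - m)).-1.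
  rewrite inE => /eqP <-.
  have -> : (#|F| ^ \dim W)%N = #|[set w | w \in W]|.
    by rewrite cardsE; symmetry; apply: card_vspace.
  rewrite [in RHS](cardsD1 0) inE mem0v /=; apply: eq_card => w; by rewrite !inE.
have KG : (K * (#|F| ^ n).-1 <= #|G| * (#|F| ^ (n - m)).-1)%N.
  rewrite -cV mulnC -sum_nat_const -[leqRHS]sum_nat_const.
  rewrite -(eq_bigr _ cW).
  under [leqRHS]eq_bigr do rewrite -sum1dep_card big_mkcondr.
  rewrite exchange_big /= big_mkcond /= [leqRHS]big_mkcond /=.
  apply: leq_sum => w _; rewrite inE; case: ifP => // w0.
  apply: leq_trans (leq_card_subspaces_containing _ v0 w0) _.
  rewrite -big_mkcondr sum1dep_card; apply: subset_leq_card.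
  by apply/fintype.subsetP=> W; rewrite !inE.
have Fn : (0 < (#|F| ^ n).-1)%N by rewrite -subn1 subn_gt0 -{1}(exp1n n) ltn_exp2r.
rewrite -(leq_pmul2r Fn) mulnAC.
apply: leq_trans (leq_mul KG (leqnn (#|F| ^ m))) _.
rewrite -mulnA leq_mul2l; apply/orP; right.
rewrite -!subn1 mulnBl -expnD subnK // mul1n leq_sub2l //.
by rewrite expn_gt0 (ltnW F1).
Qed.

(** * Cosets of a subspace *)

Lemma in_vcoset (p n : nat) (x y : 'rV['F_p]_n) (W : {vspace 'rV['F_p]_n}) :
  (y \in vcoset x W) = (y - x \in W).
Proof.
apply/imsetP/idP => [[w wW ->]|yxW]; first by rewrite addrAC subrr add0r.
by exists (y - x); rewrite // addrC subrK.
Qed.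

Lemma eq_vcoset (p n : nat) (x y : 'rV['F_p]_n) (W : {vspace 'rV['F_p]_n}) :
  (vcoset x W == vcoset y W) = (x - y \in W).
Proof.
apply/eqP/idP => [xyW|xyW]; first by rewrite -in_vcoset -xyW in_vcoset subrr mem0v.
apply/setP=> z; rewrite !in_vcoset.
have -> : z - y = (z - x) + (x - y) by rewrite addrA subrK.
by apply/esym/rpredDr.
Qed.

(** Exhibits the projection as an image of [E], the form required by the fibre count. *)
Lemma cosets_meetingE (p n : nat) (W : {vspace 'rV['F_p]_n})
    (E : {set 'rV['F_p]_n}) :
  cosets_meeting W E = [set vcoset x W | x in E].
Proof.
apply/setP=> c; apply/imsetP/imsetP => [[x + ->]|[x xE ->]].
  rewrite inE => /set0Pn[y]; rewrite inE in_vcoset => /andP[yE yx].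
  by exists y => //; apply/eqP; rewrite eq_sym eq_vcoset.
exists x => //; rewrite inE; apply/set0Pn; exists x.
by rewrite inE xE in_vcoset subrr mem0v.
Qed.

(** Once [W] is the kernel of a linear map to ['rV_m], its cosets are fibres of that map, hence
    indexed by vectors of ['rV_m]. *)
Lemma card_cosets_meeting_leq (p n m : nat) (W : {vspace 'rV['F_p]_n})
    (E : {set 'rV['F_p]_n}) :
  prime p -> (m <= n)%N -> \dim W = (n - m)%N ->
  (#|cosets_meeting W E| <= p ^ m)%N.
Proof.
move=> pp mn /(vspace_kermx mn)[A _ AW].
have -> : (p ^ m)%N = #|(finset.setT : {set 'rV['F_p]_m})|
  by rewrite finset.cardsT card_mx mul1n card_Fp.
rewrite cosets_meetingE.
apply: leq_trans (leq_imset_card (fun y => [set z | z *m A == y]) _).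
apply/subset_leq_card/fintype.subsetP => _ /imsetP[x _ ->]; apply/imsetP.
exists (x *m A); rewrite ?inE //.
by apply/setP => z; rewrite in_vcoset AW mulmxBl subr_eq0 inE.
Qed.

(** * The pair counts [P_W = #|coset_pairs E W|] and their sum over [W] *)

Definition coset_pairs (p n : nat) (E : {set 'rV['F_p]_n})
    (W : {vspace 'rV['F_p]_n}) : {set 'rV['F_p]_n * 'rV['F_p]_n} :=
  [set u in finset.setX E E | u.1 - u.2 \in W].

Lemma card_coset_pairs_geq (p n : nat) (E : {set 'rV['F_p]_n})
    (W : {vspace 'rV['F_p]_n}) :
  (#|E| <= #|coset_pairs E W|)%N.
Proof.
have diag_inj : injective (fun x : 'rV['F_p]_n => (x, x)) by move=> x y [].
rewrite -(card_imset _ diag_inj); apply/subset_leq_card/fintype.subsetP => _ /imsetP[x xE ->].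
by rewrite inE finset.in_setX /= xE subrr mem0v.
Qed.

Lemma card_sqr_leq_cosets (p n : nat) (E : {set 'rV['F_p]_n})
    (W : {vspace 'rV['F_p]_n}) :
  (#|E| ^ 2 <= #|cosets_meeting W E| * #|coset_pairs E W|)%N.
Proof.
rewrite cosets_meetingE; apply: leq_trans (card_sqr_leq_fiber_pairs (fun x => vcoset x W) E) _.
rewrite leq_mul2l; apply/orP; right; apply/subset_leq_card/fintype.subsetP => u.
by rewrite !inE eq_vcoset.
Qed.

(** Exchanging sums weights each pair by the number of [W] containing its difference. A diagonal
    pair weighs at most [|G|], any other at most [|G| / p^m]. Multiplying by [p ^ m] keeps the
    estimate in [nat]. *)
Lemma sum_coset_pairs (p n m : nat) (E : {set 'rV['F_p]_n}) :
  prime p -> (m <= n)%N ->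
  ((\sum_(W in Grassmannian p n (n - m)) #|coset_pairs E W|) * p ^ m
   <= #|Grassmannian p n (n - m)| * (#|E| * p ^ m + #|E| ^ 2))%N.
Proof.
move=> pp mn; set G := Grassmannian _ _ _.
pose K v := #|[set W : {vspace 'rV['F_p]_n} | (\dim W == n - m)%N && (v \in W)]|.
have -> : (\sum_(W in G) #|coset_pairs E W| = \sum_(u in finset.setX E E) K (u.1 - u.2)%R)%N.
  under eq_bigr do rewrite -sum1_card big_mkcond.
  rewrite exchange_big /= [RHS]big_mkcond; apply: eq_bigr => u _ /=.
  rewrite -big_mkcondr /=; case: ifP => uE; last first.
    by rewrite big1 // => W /andP[_]; rewrite inE uE.
  have uEE : (u.1 \in E) && (u.2 \in E) by move: uE; rewrite inE.
  by rewrite sum1dep_card; apply: eq_card => W; rewrite !inE uEE.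
have uE : (\sum_(u in finset.setX E E) K (u.1 - u.2)%R <= \sum_(u in finset.setX E E)
   ((u.1 == u.2) * #|G| + K (u.1 - u.2)%R * (u.1 != u.2)))%N.
  apply: leq_sum => u _; case: eqP => [->|_]; last by rewrite mul0n muln1.
  rewrite mul1n muln0 addn0; apply/subset_leq_card/fintype.subsetP => W.
  by rewrite !inE => /andP[].
apply: leq_trans (leq_mul uE (leqnn _)) _; rewrite big_split /= mulnDl mulnDr.
apply: leq_add.
  rewrite -big_distrl /= -mulnA mulnCA leq_mul2l; apply/orP; right.
  rewrite leq_mul2r; apply/orP; right.
  rewrite -big_mkcondr /= sum1_card.
  rewrite -(card_imset (mem E) (_ : injective (fun x => (x, x)))); last by move=> x y [].
  apply/subset_leq_card/fintype.subsetP => -[x y].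
  rewrite unfold_in /= finset.in_setX => /andP[/andP[xE _] /eqP <-].
  exact: imset_f.
rewrite big_distrl /= mulnC -mulnn -cardsX -sum_nat_const; apply: leq_sum => u _.
case: eqP => [_|/eqP u12]; rewrite ?muln0 // muln1.
rewrite -[X in (_ * X ^ _)%N](card_Fp pp).
by apply: card_subspaces_containing; rewrite ?subr_eq0.
Qed.

(** * The size of the Grassmannian, Markov's inequality and the three bounds *)

Lemma card_Grassmannian_leq (R : realType) (p n m : nat) :
  prime p -> (m <= n)%N ->
  #|Grassmannian p n (n - m)|%:R <= gauss_binomial R p n m.
Proof.
move=> pp mn; have p1 := prime_gt1 pp.
(* Truncated subtraction agrees with that of [R] because [i < m <= k]. *)
have castE k : (m <= k)%N -> \prod_(i < m) (p%:R ^+ k - p%:R ^+ i) =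
    (\prod_(i < m) (p ^ k - p ^ i))%N%:R :> R.
  move=> mk; rewrite natr_prod; apply: eq_bigr => i _.
  by rewrite natrB ?natrX // leq_exp2l // (leq_trans (ltnW (ltn_ord i))).
rewrite /gauss_binomial !castE // ler_pdivlMr; last first.
  by rewrite ltr0n prodn_gt0 // => i; rewrite subn_gt0 ltn_exp2l.
by have := card_codim_leq 'F_p mn; rewrite card_Fp // -natrM ler_nat.
Qed.

(** Markov's inequality for [f - c], nonnegative on [A]. Subtracting a pointwise lower bound cancels
    one of the two terms that bound the sum of the [P_W]. *)
Lemma markov_excess (R : realDomainType) (I : finType) (A : {set I})
    (Q : pred I) (f : I -> R) (c d : R) :
  (forall i, i \in A -> c <= f i) ->
  (forall i, i \in A -> Q i -> c + d <= f i) ->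
  #|[set i in A | Q i]|%:R * d <= \sum_(i in A) f i - #|A|%:R * c.
Proof.
move=> fc fd; rewrite !mulr_natl -!sumr_const -sumrB big_mkcond [leRHS]big_mkcond /=.
apply: ler_sum => i _; rewrite inE; case: (boolP (i \in A)) => //= iA.
by case: ifP => [/(fd i iA)|_]; rewrite ?subr_ge0 ?fc // lerBrDl.
Qed.

Theorem corollary1p3 (R : realType) (n m p : nat)
    (m_ge1 : (1 <= m)%N) (m_le : (m <= n - 1)%N) (p_prime : prime p)
    (p_large : p%:R ^+ (m * (n - m)) <= gauss_binomial R p n m
                 <= 2 * p%:R ^+ (m * (n - m)))
    (E : {set 'rV['F_p]_n}) (s : R) (cardE : #|E|%:R = p%:R `^ s) :
  [/\ s <= m%:R ->
      forall t : R, 0 < t -> t <= s ->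
        #|[set W in Grassmannian p n (n - m)
            | #|cosets_meeting W E|%:R <= p%:R `^ t / 10]|%:R
        <= 2^-1 * p%:R `^ ((m * (n - m))%:R - (m%:R - t)),
      m%:R < s ->
        #|[set W in Grassmannian p n (n - m)
            | #|cosets_meeting W E|%:R <= (p%:R ^+ m / 10 : R)]|%:R
        <= 2^-1 * p%:R `^ ((m * (n - m))%:R - (s - m%:R))
    & 2 * m%:R < s ->
        #|[set W in Grassmannian p n (n - m)
            | #|cosets_meeting W E| != (p ^ m)%N]|%:R
        <= 4 * p%:R `^ ((m * (n - m))%:R - (s - 2 * m%:R))].
Proof.
have mn : (m <= n)%N by rewrite (leq_trans m_le) // leq_subr.
have p0 : 0 < p%:R :> R by rewrite ltr0n prime_gt0.
have powB x y : p%:R `^ (x - y) = p%:R `^ x / p%:R `^ y :> R.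
  by rewrite powRB // (gt_eqF p0) implybT.
have G_le := le_trans (card_Grassmannian_leq R p_prime mn) (andP p_large).2.
have sum_le : (\sum_(W in Grassmannian p n (n - m)) #|coset_pairs E W|%:R) * p%:R ^+ m <=
    #|Grassmannian p n (n - m)|%:R * (#|E|%:R * p%:R ^+ m + #|E|%:R ^+ 2) :> R.
  by rewrite -natr_sum -!natrX -!natrM -natrD -natrM ler_nat sum_coset_pairs.
have cs W : #|E|%:R ^+ 2 <= #|cosets_meeting W E|%:R * #|coset_pairs E W|%:R :> R.
  by rewrite -natrX -natrM ler_nat card_sqr_leq_cosets.
have pairs_ge W : #|E|%:R <= #|coset_pairs E W|%:R :> R.
  by rewrite ler_nat card_coset_pairs_geq.
have cosets_le W : W \in Grassmannian p n (n - m) -> (#|cosets_meeting W E| <= p ^ m)%N.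
  by rewrite inE => /eqP; apply: card_cosets_meeting_leq.
have e0 : 0 < #|E|%:R :> R by rewrite cardE powR_gt0.
rewrite !powB !powR_mulrn ?(ltW p0) //.
rewrite -!cardE.
move: sum_le G_le cs pairs_ge cosets_le e0 cardE.
(* With [e = p^s], [q = p^m] and [M = p^(m(n-m))], and later [T = p^t] in (a), the bounds become
   inequalities between rational expressions. *)
set e : R := #|E|%:R; set q : R := p%:R ^+ m; set M : R := p%:R ^+ _.
set G := Grassmannian p n (n - m); set g : R := #|G|%:R.
move=> sum_le G_le cs pairs_ge cosets_le e0 cardE.
have q0 : 0 < q by rewrite exprn_gt0.
have M0 : 0 < M by rewrite exprn_gt0.
(* Cauchy-Schwarz with at most [q] cosets: the baseline for (b) and (c). *)
have pairs_ge' W : W \in G -> e ^+ 2 / q <= #|coset_pairs E W|%:R.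
  move=> /cosets_le NW; rewrite ler_pdivrMr // mulrC (le_trans (cs W)) //.
  by rewrite ler_wpM2r // /q -natrX ler_nat.
have sum_le' : \sum_(W in G) #|coset_pairs E W|%:R <= g * e + g * e ^+ 2 / q.
  by rewrite -(ler_pM2r q0) mulrDl divfK ?gt_eqF // (le_trans sum_le) // mulrDr mulrA.
(* The total excess over the baseline [e^2 / q] is at most [g e <= 2 M e]. *)
have tail_le (Q : pred _) d : 0 < d ->
    (forall W, W \in G -> Q W -> e ^+ 2 / q + d <= #|coset_pairs E W|%:R) ->
    #|[set W in G | Q W]|%:R <= 2 * M * e / d.
  move=> d0 Qd; rewrite ler_pdivlMr //.
  apply: le_trans (markov_excess pairs_ge' Qd) _.
  rewrite lerBlDr mulrA (le_trans sum_le') // lerD2r ler_wpM2r // ltW //.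
split=> [_ t t0 ts|ms|ms].
- have T0 : 0 < p%:R `^ t :> R by rewrite powR_gt0.
  have Te : p%:R `^ t <= e by rewrite cardE ler_powR // ler1n prime_gt0.
  rewrite !powB !powR_mulrn ?(ltW p0) // -/q -/M.
  move: T0 Te; move: (p%:R `^ t) => T T0 Te.
  (* A projection of size at most [T / 10] forces [P_W >= 10 e^2 / T], and [e <= e^2 / T] since
     [T <= e]. This leaves an excess of [9 e^2 / T] over the baseline [e], and Markov yields the
     constant 2/9, below 1/2. *)
  have d0 : 0 < 9 * (e ^+ 2 / T) by rewrite mulr_gt0 // divr_gt0 // exprn_gt0.
  rewrite -(ler_pM2r d0).
  apply: le_trans (_ : _ <= 2 * M * (e ^+ 2 / q)) _; last first.
    have -> : 2^-1 * (M / (q / T)) * (9 * (e ^+ 2 / T)) = 9 / 2 * M * (e ^+ 2 / q).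
      by field; rewrite !gt_eqF.
    by rewrite ler_pM2r ?divr_gt0 ?exprn_gt0 // ler_pM2r //; lra.
  apply: le_trans (markov_excess (f := fun W => #|coset_pairs E W|%:R) (c := e) _ _) _ => //.
    move=> W _ NW.
    have eT : e <= e ^+ 2 / T by rewrite ler_pdivlMr // expr2 ler_pM2l.
    have : e ^+ 2 <= T / 10 * #|coset_pairs E W|%:R.
      by apply: le_trans (cs W) _; rewrite ler_wpM2r.
    rewrite mulrAC -mulrA -ler_pdivrMl // mulrC => le10; lra.
  by rewrite lerBlDl (le_trans sum_le') // lerD2l -mulrA ler_pM2r ?divr_gt0 ?exprn_gt0.
(* Here [P_W >= 10 e^2 / q], ten times the baseline, so the excess is [9 e^2 / q] and the constant
   is again 2/9. *)
- apply: le_trans (tail_le _ (9 * (e ^+ 2 / q)) _ _) _.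
  + by rewrite mulr_gt0 // divr_gt0 // exprn_gt0.
  + move=> W _ NW.
    have : e ^+ 2 <= q / 10 * #|coset_pairs E W|%:R.
      by apply: le_trans (cs W) _; rewrite ler_wpM2r.
    rewrite mulrAC -mulrA -ler_pdivrMl // mulrC => le10; lra.
  + have -> : 2 * M * e / (9 * (e ^+ 2 / q)) = 2 / 9 * (M / (e / q)).
      by field; rewrite !gt_eqF.
    by rewrite ler_pM2r ?divr_gt0 //; lra.
- have -> : p%:R `^ (2 * m%:R) = q ^+ 2 :> R.
    by rewrite -natrM powR_mulrn ?(ltW p0) // mulnC exprM.
  (* Missing a coset leaves at most [q - 1] of them, so [e^2 <= (q - 1) P_W]. Since
     [(q - 1)(q + 1) <= q^2], the excess over [e^2 / q] is at least [e^2 / q^2]. *)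
  apply: le_trans (tail_le _ (e ^+ 2 / q ^+ 2) _ _) _.
  + by rewrite divr_gt0 // exprn_gt0.
  + move=> W /cosets_le + NW; rewrite leq_eqVlt (negPf NW) /= => Nq.
    have {}Nq : #|cosets_meeting W E|%:R <= q - 1.
      by rewrite lerBrDr /q -natrX natr1 ler_nat.
    have [P0 le2] : 0 < (#|coset_pairs E W|%:R : R) /\
        e ^+ 2 <= (q - 1) * #|coset_pairs E W|%:R.
      split; first exact: lt_le_trans (pairs_ge W).
      by apply: le_trans (cs W) _; rewrite ler_wpM2r.
    have -> : e ^+ 2 / q + e ^+ 2 / q ^+ 2 = e ^+ 2 * (q + 1) / q ^+ 2.
      by field; rewrite gt_eqF.
    rewrite ler_pdivrMr ?exprn_gt0 //.
    have q1 : 0 < q + 1 by rewrite addr_gt0.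
    move: le2; rewrite -(ler_pM2r q1) => /le_trans; apply; nra.
  + have -> : 2 * M * e / (e ^+ 2 / q ^+ 2) = 2 * (M / (e / q ^+ 2)).
      by field; rewrite !gt_eqF.
    by rewrite ler_pM2r ?divr_gt0 ?exprn_gt0 //; lra.
Qed.
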